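(* Let $G$ be an ordered abelian group and $H \subsetneq G$ a convex subgroup. Suppose that for every integer $n \geq 2$ the quotient $G/H$ has a non-trivial $n$-divisible convex subgroup and at least one of the following holds: (a) $v_G(H\setminus\{0\})$ has a minimum, or (b) there is a convex subgroup $H' \subsetneq H$ such that $H/H'$ is $n$-divisible. Then $H$ is not $\mathcal{L}_{\mathrm{og}}$-definable in $G$.
   Context: All orderings are linear. $\mathcal{L}_{\mathrm{og}}=\{+,-,0,<\}$ is the language of ordered groups, and ''definable'' means first-order definable with parameters from the structure. Two elements $a,b \in G$ are archimedean equivalent, $a\sim b$, if there is $n\in\mathbb{N}=\{1,2,\dots\}$ with $|a|\le n|b|$ and $|b|\le n|a|$; $[a]_+$ denotes the equivalence class of $a$. The set of classes is ordered by $[a]_+<[b]_+ :\Leftrightarrow |a|>|b|$ and $a\not\sim b$. The natural valuation on $G$ is $v_G\colon a\mapsto [a]_+$. Quotients by convex subgroups carry the induced ordering. *)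

(* Defs.v *)
From HB Require Import structures.
From mathcomp Require Import all_boot all_order all_algebra.
From mathcomp Require Import generic_quotient ring_quotient.
From mathcomp Require Import boolp classical_sets.

Set Implicit Arguments.
Unset Strict Implicit.
Unset Printing Implicit Defensive.

Import Order.TTheory GRing.Theory.
Local Open Scope ring_scope.

(* Totality is a field, and Order.Total is not inherited: the library's only
   join of Order.Total and GRing.Zmodule is Num.RealDomain, and Hierarchy
   Builder admits no weaker join once that one is declared. *)
HB.mixin Record isOrderedZmodule G of Num.POrderedZmodule G := {
  oz_le_total : total (<=%O : rel G);
  oz_leD2l : forall z x y : G, x <= y -> z + x <= z + y
}.

#[short(type="orderedZmodType")]
HB.structure Definition OrderedZmodule :=
  { G of Num.POrderedZmodule G & isOrderedZmodule G }.

(* Subgroups are boolean predicates, as everywhere in ssralg; in the presence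
   of the axioms of boolp, every subset of G is of this form. *)
HB.mixin Record isConvex (G : orderedZmodType) (S : G -> bool) := {
  convex_subproof : forall x y z : G,
    x \in S -> z \in S -> x <= y -> y <= z -> y \in S
}.

#[short(type="convexSubgroup")]
HB.structure Definition ConvexSubgroup (G : orderedZmodType) :=
  { S of GRing.ZmodClosed G S & isConvex G S }.

Section OrderedZmoduleTheory.
Variable G : orderedZmodType.
Implicit Types x y z : G.

Lemma oz_lerD2l z x y : (z + x <= z + y) = (x <= y).
Proof.
apply/idP/idP; last exact: oz_leD2l.
by move/(oz_leD2l (- z)); rewrite !addKr.
Qed.

Lemma oz_subr_ge0 x y : (0 <= y - x) = (x <= y).
Proof. by rewrite -(oz_lerD2l x 0) addr0 [x + _]addrC subrK. Qed.

Lemma oz_subr_le0 x y : (x - y <= 0) = (x <= y).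
Proof. by rewrite -(oz_lerD2l y (x - y)) addr0 [y + _]addrC subrK. Qed.

End OrderedZmoduleTheory.

Definition oquot (G : orderedZmodType) (H : convexSubgroup G) : Type :=
  Quotient.quot H.

Section OrderedQuotient.
Local Open Scope quotient_scope.
Variables (G : orderedZmodType) (H : convexSubgroup G).
Local Notation Q := (oquot H).

HB.instance Definition _ := Choice.on Q.
HB.instance Definition _ := GRing.Zmodule.on Q.
HB.instance Definition _ :
  ZmodQuotient G (Quotient.equiv H) 0 -%R +%R Q := ZmodQuotient.on Q.

Lemma pi_oquot_eq (x y : G) : (\pi_Q x == \pi_Q y) = (x - y \in H).
Proof. by rewrite (Quotient.idealrBE H). Qed.

(* The order is computed on representatives; pi_oquot_le below gives it on
   arbitrary elements: x + H <= y + H iff x <= y or x + H = y + H. *)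
Definition oquot_le : rel Q :=
  fun p q => (repr p <= repr q) || (repr p - repr q \in H).

Lemma oquot_le_compat (a b c d : G) : a - c \in H -> b - d \in H ->
  (a <= b) || (a - b \in H) -> (c <= d) || (c - d \in H).
Proof.
move=> ac bd.
have ecd : c - d = (a - b) + ((b - d) - (a - c)).
  by rewrite opprB [b - d + _]addrACA [b + c]addrC [c + b + _]addrACA [RHS]addrCA -[b - a]opprB subrr
    addr0.
have acbd : (b - d) - (a - c) \in H by rewrite rpredB.
have eab : (c - d \in H) = (a - b \in H) by rewrite ecd rpredDr.
case/orP => [ab|abH]; last by rewrite eab abH orbT.
case/orP: (oz_le_total c d) => [->//|dc]; apply/orP; right.
apply: (convex_subproof (0 : G) _ ((b - d) - (a - c))) => //.
- exact: rpred0.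
- by rewrite oz_subr_ge0.
- by rewrite ecd addrC -[leRHS]addr0 oz_lerD2l oz_subr_le0.
Qed.

Lemma pi_oquot_le (x y : G) :
  oquot_le (\pi_Q x) (\pi_Q y) = (x <= y) || (x - y \in H).
Proof.
have reprH z : repr (\pi_Q z) - z \in H by rewrite -pi_oquot_eq reprK.
apply/idP/idP; first exact: oquot_le_compat.
by apply: oquot_le_compat; rewrite -opprB rpredN.
Qed.

Lemma oquot_le_refl : reflexive oquot_le.
Proof. by move=> q; rewrite /oquot_le lexx. Qed.

Lemma oquot_le_anti : antisymmetric oquot_le.
Proof.
move=> p q; rewrite -[p]reprK -[q]reprK !pi_oquot_le.
move: (repr p) (repr q) => x y /andP[].
have [xyH _ _|xyH /=] := boolP (x - y \in H).
  by apply/eqP; rewrite pi_oquot_eq.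
rewrite -opprB rpredN (negbTE xyH) !orbF => xy yx.
by rewrite (le_anti (introT andP (conj xy yx))).
Qed.

Lemma oquot_le_trans : transitive oquot_le.
Proof.
move=> q p r; rewrite -[p]reprK -[q]reprK -[r]reprK !pi_oquot_le.
move: (repr p) (repr q) (repr r) => x y z /orP[xy|xyH].
  case/orP => [yz|yzH]; first by rewrite (le_trans xy yz).
  apply: (@oquot_le_compat x y); rewrite ?xy //.
  by rewrite subrr rpred0.
by apply: oquot_le_compat; rewrite ?subrr ?rpred0 // -opprB rpredN.
Qed.

HB.instance Definition _ := Order.Le_isPOrder.Build ring_display Q
  oquot_le_refl oquot_le_anti oquot_le_trans.

Lemma oquot_le_total : total (<=%O : rel Q).
Proof.
move=> p q; rewrite -[p]reprK -[q]reprK.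
change (oquot_le (\pi_Q (repr p)) (\pi_Q (repr q)) ||
        oquot_le (\pi_Q (repr q)) (\pi_Q (repr p))).
rewrite !pi_oquot_le.
by case/orP: (oz_le_total (repr p) (repr q)) => ->; rewrite ?orbT.
Qed.

Lemma oquot_leD2l (r p q : Q) : p <= q -> r + p <= r + q.
Proof.
rewrite -[p]reprK -[q]reprK -[r]reprK.
move: (repr p) (repr q) (repr r) => x y z.
rewrite -!(raddfD (\pi_Q)).
change (oquot_le (\pi_Q x) (\pi_Q y) ->
        oquot_le (\pi_Q (z + x)) (\pi_Q (z + y))).
by rewrite !pi_oquot_le oz_lerD2l opprD addrACA subrr add0r.
Qed.

HB.instance Definition _ := isOrderedZmodule.Build Q oquot_le_total oquot_leD2l.

End OrderedQuotient.

Definition strict_sub (T : Type) (A B : {pred T}) : Prop :=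
  {subset A <= B} /\ exists2 x, x \in B & x \notin A.

Definition nontrivial (G : zmodType) (S : {pred G}) : Prop :=
  exists2 x, x \in S & x != 0.

Definition n_divisible (n : nat) (G : zmodType) (S : {pred G}) : Prop :=
  forall x, x \in S -> exists2 y, y \in S & y *+ n = x.

(* H/K as a subgroup of G/K. *)
Definition sub_quot (G : orderedZmodType) (H : {pred G}) (K : convexSubgroup G)
    : {pred oquot K} :=
  fun q => `[< exists2 x, x \in H & q = \pi_(oquot K)%qT x >].

Arguments sub_quot {G} H K _.

Section NaturalValuation.
Local Open Scope classical_set_scope.
Variable G : orderedZmodType.

Definition oz_abs (x : G) : G := if 0 <= x then x else - x.

Definition arch_equiv (a b : G) : Prop :=
  exists n : nat, [/\ (0 < n)%N, oz_abs a <= oz_abs b *+ n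
                    & oz_abs b <= oz_abs a *+ n].

Definition natval (a : G) : set G := [set b | arch_equiv a b].

(* The order is reversed: larger elements have smaller value. *)
Definition arch_lt (A B : set G) : Prop :=
  exists a b : G, [/\ A = natval a, B = natval b,
                      oz_abs b < oz_abs a & ~ arch_equiv a b].

Definition has_arch_min (S : set (set G)) : Prop :=
  exists2 A, S A & forall B, S B -> A = B \/ arch_lt A B.

End NaturalValuation.

(* The language {+, -, 0, <}. Variables are de Bruijn indices; the remaining
   connectives and the universal quantifier are abbreviations. *)
Inductive og_term :=
| OgVar of nat
| OgZero
| OgOpp of og_term
| OgAdd of og_term & og_term.

Inductive og_formula :=
| OgEq of og_term & og_term
| OgLt of og_term & og_term
| OgNot of og_formula
| OgAnd of og_formula & og_formula
| OgExists of og_formula.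

Section Semantics.
Variable G : orderedZmodType.

(* Indices beyond the environment read as the constant 0. *)
Fixpoint og_eval (e : seq G) (t : og_term) : G :=
  match t with
  | OgVar i => e`_i
  | OgZero => 0
  | OgOpp t1 => - og_eval e t1
  | OgAdd t1 t2 => og_eval e t1 + og_eval e t2
  end.

Fixpoint og_holds (e : seq G) (phi : og_formula) : Prop :=
  match phi with
  | OgEq t1 t2 => og_eval e t1 = og_eval e t2
  | OgLt t1 t2 => og_eval e t1 < og_eval e t2
  | OgNot phi1 => ~ og_holds e phi1
  | OgAnd phi1 phi2 => og_holds e phi1 /\ og_holds e phi2
  | OgExists phi1 => exists x : G, og_holds (x :: e) phi1
  end.

(* The sequence b holds the parameters. *)
Definition og_definable (D : {pred G}) : Prop :=
  exists (phi : og_formula) (b : seq G),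
    forall x : G, x \in D <-> og_holds (x :: b) phi.

End Semantics.

(* Main.v *)
(* A convex subgroup H cannot be separated from its complement by a formula that
   only sees integer combinations with coefficients bounded by some N, if there
   are convex subgroups S < H < K such that K / S is N-regular: every
   sufficiently long interval of K / S contains an element divisible by n, for
   all n | N. Indeed, an Ehrenfeucht-Fraisse game is won by keeping corresponding
   elements of the two tuples congruent modulo m K, and corresponding
   combinations with coefficients bounded by m either equal, or outside S and of
   the same sign; m shrinks at each move. Elements x in H and y in K \ H are then
   found that are matched in this sense over the parameters of the formula.
   In case (b), K / S is N-divisible for S = H'. In case (a), S is the largest
   convex subgroup below the top archimedean class of H, so that H / S is
   archimedean and K / H is N-divisible. When H / S is discrete, a representative
   of its least positive element is added to the parameters. *)

From HB Require Import structures.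
Require Import Defs.
From mathcomp Require Import all_boot all_order all_algebra.
From mathcomp Require Import generic_quotient.
From mathcomp Require Import boolp classical_sets.
From mathcomp Require Import ring zify.

Set Implicit Arguments.
Unset Strict Implicit.
Unset Printing Implicit Defensive.

Import Order.TTheory GRing.Theory.
Local Open Scope ring_scope.

(* Every abelian group V embeds into the additive group of the commutative ring
   Z + V in which V has square zero, where the ring tactic applies. *)
Section Idealization.
Variable V : zmodType.

Definition idealization : Type := (int * V)%type.
HB.instance Definition _ := GRing.Zmodule.on idealization.

Definition idealization_one : idealization := (1, 0).
Definition idealization_mul (x y : idealization) : idealization :=
  (x.1 * y.1, y.2 *~ x.1 + x.2 *~ y.1).

Fact idealization_mulA : associative idealization_mul.
Proof.
move=> [a x] [b y] [c z]; rewrite /idealization_mul /= !mulrzDl -!mulrzA.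
by rewrite mulrA addrA (mulrC b a) (mulrC c a).
Qed.

Fact idealization_mulC : commutative idealization_mul.
Proof.
by move=> [a x] [b y]; rewrite /idealization_mul /= mulrC [X in (_, X)]addrC.
Qed.

Fact idealization_mul1 : left_id idealization_one idealization_mul.
Proof.
by move=> [a x]; rewrite /idealization_mul /= mul1r mul0rz addr0.
Qed.

Fact idealization_mulDl : left_distributive idealization_mul +%R.
Proof.
move=> [a x] [b y] [c z]; rewrite /idealization_mul /= mulrDl mulrzDr mulrzDl.
by congr pair; rewrite addrACA.
Qed.

Fact idealization_one_neq0 : idealization_one != 0.
Proof. by []. Qed.

HB.instance Definition _ := GRing.Zmodule_isComNzRing.Build idealization
  idealization_mulA idealization_mulC idealization_mul1 idealization_mulDl
  idealization_one_neq0.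

Definition to_idealization (x : V) : idealization := (0, x).

Fact to_idealization_zmod : zmod_morphism to_idealization.
Proof. by move=> x y; congr pair. Qed.

HB.instance Definition _ :=
  GRing.isZmodMorphism.Build V idealization to_idealization
    to_idealization_zmod.

Lemma to_idealization_inj : injective to_idealization.
Proof. by move=> x y []. Qed.

End Idealization.

Ltac zmod := apply: to_idealization_inj; ring.

(** * Signs in G and in the quotients by convex subgroups *)

Section Order.
Variable G : orderedZmodType.
Implicit Types (x y z : G) (S K : convexSubgroup G).

Lemma oz_lerDl x y : 0 <= y -> x <= x + y.
Proof. by move=> y0; rewrite -{1}[x]addr0 oz_lerD2l. Qed.

Lemma oz_addr_ge0 x y : 0 <= x -> 0 <= y -> 0 <= x + y.
Proof. by move=> x0 y0; apply: le_trans x0 (oz_lerDl x y0). Qed.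

Lemma oz_mulrn_ge0 x n : 0 <= x -> 0 <= x *+ n.
Proof.
move=> x0; elim: n => [|n IHn]; first by rewrite mulr0n.
by rewrite mulrS oz_addr_ge0.
Qed.

Lemma oz_ler_mulrn x n : 0 <= x -> (0 < n)%N -> x <= x *+ n.
Proof. by case: n => // n x0 _; rewrite mulrS oz_lerDl // oz_mulrn_ge0. Qed.

Lemma oz_oppr_ge0 x : (0 <= - x) = (x <= 0).
Proof. by rewrite -(oz_lerD2l x 0) addr0 subrr. Qed.

Lemma oz_ge0_or_le0 x : 0 <= x \/ 0 <= - x.
Proof. by rewrite oz_oppr_ge0; case/orP: (oz_le_total 0 x); [left|right]. Qed.

Lemma oz_mulrn_eq0 x n : (0 < n)%N -> x *+ n = 0 -> x = 0.
Proof.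
move=> n0 xn0; case: (oz_ge0_or_le0 x) => x0.
  by apply/le_anti; rewrite x0 -{1}xn0 oz_ler_mulrn.
apply/eqP; rewrite -oppr_eq0; apply/eqP/le_anti.
by rewrite x0 -[X in _ <= X]oppr0 -{1}xn0 -mulNrn oz_ler_mulrn.
Qed.

Lemma oz_mulrn_inj n : (0 < n)%N -> injective (fun x => x *+ n).
Proof.
move=> n0 x y /eqP; rewrite -subr_eq0 -mulrnBl => /eqP /(oz_mulrn_eq0 n0) /eqP.
by rewrite subr_eq0 => /eqP.
Qed.

Lemma seq_max (a : G) (s : seq G) :
  exists2 x, x \in a :: s & forall y, y \in a :: s -> y <= x.
Proof.
elim: s a => [|b s IHs] a.
  by exists a; rewrite ?mem_head // => y; rewrite inE => /eqP ->.
have [x xs xmax] := IHs b; case/orP: (oz_le_total a x) => ax.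
  exists x; first by rewrite inE xs orbT.
  by move=> y; rewrite inE => /predU1P[->|/xmax].
exists a; first exact: mem_head.
move=> y; rewrite inE => /predU1P[->//|/xmax yx]; exact: le_trans yx ax.
Qed.

Lemma seq_min (a : G) (s : seq G) :
  exists2 x, x \in a :: s & forall y, y \in a :: s -> x <= y.
Proof.
have [c cs cmax] := seq_max (- a) (map -%R s).
rewrite -map_cons in cs cmax; case/mapP: cs => x xs ec.
exists x => // y ys; have := cmax _ (map_f -%R ys).
by rewrite ec -(oz_lerD2l (x + y)); congr (_ <= _); zmod.
Qed.

(* The coset x + S is positive in G / S. *)
Definition posm S x := (0 <= x) && (x \notin S).

Lemma posm_ge0 S x : posm S x -> 0 <= x. Proof. by case/andP. Qed.

Lemma posm_notin S x : posm S x -> x \notin S. Proof. by case/andP. Qed.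

(** For y in S: if x + y were at most 0, then x would lie between 0 and -y, hence in S by
    convexity. *)
Lemma posmD S x y : posm S x -> 0 <= y \/ y \in S -> posm S (x + y).
Proof.
case/andP=> x0 xS [y0|yS].
  rewrite /posm oz_addr_ge0 //=; apply: contra xS => xyS.
  exact: convex_subproof (rpred0 S) xyS x0 (oz_lerDl x y0).
rewrite /posm rpredDr // xS andbT.
case: (oz_ge0_or_le0 (x + y)) => // xy0; case/negP: xS.
apply: (convex_subproof (0 : G) _ (- y)) (rpred0 S) _ x0 _; rewrite ?rpredN //.
by rewrite -(oz_lerD2l (y)) subrr addrC -oz_oppr_ge0.
Qed.

Lemma posm_trich S x : [\/ x \in S, posm S x | posm S (- x)].
Proof.
have [xS|xS] := boolP (x \in S); first by constructor 1.
by case: (oz_ge0_or_le0 x) => x0; [constructor 2|constructor 3];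
  rewrite /posm x0 ?rpredN.
Qed.

Lemma posm_anti S x : posm S x -> posm S (- x) -> False.
Proof.
move=> px /posm_ge0 nx; have := posmD px (or_introl nx).
by rewrite subrr => /posm_notin; rewrite rpred0.
Qed.

Lemma posm_muln S x n : (0 < n)%N -> posm S x -> posm S (x *+ n).
Proof.
case: n => // n _ px; rewrite mulrS posmD //; left.
exact/oz_mulrn_ge0/posm_ge0/px.
Qed.

Lemma posm_muln_inv S x n : (0 < n)%N -> posm S (x *+ n) -> posm S x.
Proof.
move=> n0 pxn; case: (posm_trich S x) => // [xS|px].
  by move: (posm_notin pxn); rewrite rpredMn.
by case: (posm_anti pxn); rewrite -mulNrn posm_muln.
Qed.

Lemma posm_gap S K :
  (exists2 g, g \in K & g \notin S) -> exists2 g, g \in K & posm S g.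
Proof.
case=> g gK gS; case: (posm_trich S g) => [|pg|pg].
- by rewrite (negbTE gS).
- by exists g.
- by exists (- g); rewrite ?rpredN.
Qed.

Lemma posm_sub S K x : {subset S <= K} -> posm K x -> posm S x.
Proof. by move=> SK /andP[x0 xK]; rewrite /posm x0 (contra (SK _) xK). Qed.

(** The first alternative is equality in G, not modulo S, so that the atoms = and < transfer
    exactly. *)
Definition same_side S (p : G * G) :=
  [\/ p.1 = p.2, posm S p.1 /\ posm S p.2 | posm S (- p.1) /\ posm S (- p.2)].

Lemma same_sideN S p : same_side S p -> same_side S (- p).
Proof.
rewrite /same_side /= !opprK; case=> [->|H|H];
  by [constructor 1|constructor 3|constructor 2].
Qed.

Lemma same_side_swap S p : same_side S p -> same_side S (p.2, p.1).
Proof.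
by case=> [->|[H1 H2]|[H1 H2]];
  [constructor 1|constructor 2|constructor 3].
Qed.

(** G is torsion-free, and a positive factor preserves signs modulo S. This allows comparisons to be
    made after multiplication by a common factor. *)
Lemma same_side_muln_inv S p n :
  (0 < n)%N -> same_side S (p *+ n) -> same_side S p.
Proof.
move=> n0; have fstMn : (p *+ n).1 = p.1 *+ n by rewrite raddfMn.
have sndMn : (p *+ n).2 = p.2 *+ n by rewrite raddfMn.
rewrite /same_side fstMn sndMn -!mulNrn.
case=> [/(oz_mulrn_inj n0)|[H1 H2]|[H1 H2]].
- by constructor 1.
- by constructor 2; split; apply: posm_muln_inv n0 _.
- by constructor 3; split; apply: posm_muln_inv n0 _.
Qed.

Lemma same_sideD S p h : h \in S -> same_side S p -> same_side S (p + (h, h)).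
Proof.
move=> hS; rewrite /same_side /=; case=> [->|[H1 H2]|[H1 H2]].
- by constructor 1.
- by constructor 2; split; apply: posmD => //; right.
- by constructor 3; rewrite !opprD; split; apply: posmD => //; right;
    rewrite rpredN.
Qed.

Lemma same_side_posm S p : same_side S p -> posm S p.1 -> posm S p.2.
Proof.
by case=> [->|[]|[np _] pp] //; case: (posm_anti pp np).
Qed.

Lemma same_side_eq0 S p : same_side S p -> p.1 = 0 -> p.2 = 0.
Proof.
case=> [->|[p1 _]|[p1 _]] // p0; move: (posm_notin p1);
  by rewrite p0 ?oppr0 rpred0.
Qed.

Lemma same_side_gt0 S p : same_side S p -> 0 < p.1 -> 0 < p.2.
Proof.
case=> [->|[_ /andP[p0 pS]]|[/posm_ge0 p0 _]] //; rewrite !lt_def.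
  by move=> _; rewrite p0 andbT; apply: contra pS => /eqP ->; rewrite rpred0.
by rewrite oz_oppr_ge0 in p0; case/andP => pn0 p0';
  case/eqP: pn0; apply/le_anti; rewrite p0.
Qed.

End Order.

(** * Integer combinations with bounded coefficients *)

Section Combinations.
Variable V : zmodType.
Implicit Types (s : seq V) (p q : V).

Definition int_range m : seq int :=
  [seq i%:Z - m%:Z | i <- iota 0 (2 * m).+1].

Lemma mem_int_range m z : (z \in int_range m) = (`|z| <= m)%N.
Proof.
apply/mapP/idP => [[i]|zm]; first by rewrite mem_iota => /andP[_ im] ->; lia.
by exists (absz (z + m%:Z)); [rewrite mem_iota|]; lia.
Qed.

(** A finite list rather than a predicate, so that greatest and least combinations exist. *)
Definition combs m s : seq V :=
  foldr (fun a r => [seq a *~ z + q | z <- int_range m, q <- r]) [:: 0] s.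

Lemma combs_nil m p : (p \in combs m [::]) = (p == 0).
Proof. by rewrite inE. Qed.

Lemma combs_consP m a s p :
  reflect (exists z q, [/\ (`|z| <= m)%N, q \in combs m s & p = a *~ z + q])
          (p \in combs m (a :: s)).
Proof.
apply: (iffP allpairsP) => [[[z q] /= [zm qs ->]]|[z [q [zm qs ->]]]].
  by exists z, q; rewrite -mem_int_range.
by exists (z, q); rewrite mem_int_range.
Qed.

Lemma combsD m n s p q :
  p \in combs m s -> q \in combs n s -> p + q \in combs (m + n) s.
Proof.
elim: s p q => [|a s IHs] p q.
  by rewrite !combs_nil => /eqP -> /eqP ->; rewrite addr0.
case/combs_consP=> z [p' [zm p's ->]] /combs_consP[w [q' [wn q's ->]]].
apply/combs_consP; exists (z + w), (p' + q'); split; [lia|exact: IHs|zmod].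
Qed.

Lemma combsMz m k z s p : (`|z| <= k)%N ->
  p \in combs m s -> p *~ z \in combs (m * k) s.
Proof.
move=> zk; elim: s p => [|a s IHs] p.
  by rewrite !combs_nil => /eqP ->; rewrite mul0rz.
case/combs_consP=> w [q [wm qs ->]].
apply/combs_consP; exists (w * z), (q *~ z); split; [|exact: IHs|zmod].
by rewrite abszM leq_mul.
Qed.

Lemma combsMn m k n s p : (n <= k)%N ->
  p \in combs m s -> p *+ n \in combs (m * k) s.
Proof. exact: (@combsMz m k n). Qed.

Lemma combsN m s p : p \in combs m s -> - p \in combs m s.
Proof. by move/(@combsMz m 1 (-1) _ _ isT); rewrite muln1 mulrN1z. Qed.

Lemma combsS m n s : (m <= n)%N -> {subset combs m s <= combs n s}.
Proof.
move=> mn; elim: s => [//|a s IHs] p /combs_consP[z [q [zm qs ->]]].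
apply/combs_consP; exists z, q; split=> //; [exact: leq_trans mn|exact: IHs].
Qed.

Lemma combs0 m s : 0 \in combs m s.
Proof.
elim: s => [|a s IHs]; first by rewrite combs_nil.
by apply/combs_consP; exists 0, 0; rewrite mulr0z addr0.
Qed.

Lemma mem_combs s p : p \in s -> p \in combs 1 s.
Proof.
elim: s => [//|a s IHs]; rewrite inE => /predU1P[->|ps]; apply/combs_consP.
  by exists 1, 0; rewrite combs0 addr0 mulr1z.
by exists 0, p; rewrite IHs // mulr0z add0r.
Qed.

End Combinations.

Lemma combs_map (V W : zmodType) (f : {additive V -> W}) m s q :
  q \in combs m (map f s) -> exists2 p, p \in combs m s & q = f p.
Proof.
elim: s q => [|a s IHs] q.
  by rewrite combs_nil => /eqP ->; exists 0; rewrite ?combs_nil ?raddf0.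
case/combs_consP=> z [r [zm /IHs[p ps ->] ->]]; exists (a *~ z + p).
  by apply/combs_consP; exists z, p.
by rewrite raddfD raddfMz.
Qed.

(** * Matched tuples and the extension move of the game *)

Section Game.
Variables (G : orderedZmodType) (S K : convexSubgroup G) (one : G).
Implicit Types (x y z : G) (s : seq (G * G)) (p q : G * G).

(* The interval has to be long because of discrete K / S, where one is the least
   positive element; otherwise one = 0. *)
Definition regular_at (n : nat) : Prop :=
  forall p1 p2 : G, p1 \in K -> p2 \in K ->
    posm S (p2 - p1 - one *+ (2 * n)) ->
    exists2 t, t \in K & posm S (t *+ n - p1) /\ posm S (p2 - t *+ n).

(** The third clause leaves no positive coset of G / S below that of [one]; it holds trivially for
    [one] = 0. *)
Definition regular (N : nat) : Prop :=
  [/\ {subset S <= K} /\ (exists2 g, g \in K & g \notin S),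
      one \in K,
      forall z, posm S z -> z - one \notin S -> posm S (z - one)
    & forall n, (0 < n)%N -> (n %| N)%N -> regular_at n].

Definition congr_pair (n : nat) p : Prop :=
  exists2 k, k \in K & p.2 = p.1 + k *+ n.

Definition matched (m : nat) s : Prop :=
  (forall p, p \in s -> congr_pair m p) /\
  (forall p, p \in combs m s -> same_side S p).

Lemma congr_pair_dvd m n p : (m %| n)%N -> congr_pair n p -> congr_pair m p.
Proof.
case/dvdnP=> d -> [k kK ek]; exists (k *+ d); first by rewrite rpredMn.
rewrite ek; zmod.
Qed.

Lemma congr_combs n m s :
  (forall p, p \in s -> congr_pair n p) ->
  forall p, p \in combs m s -> congr_pair n p.
Proof.
elim: s => [|a s IHs] sn p.
  by rewrite combs_nil => /eqP ->; exists 0; rewrite ?rpred0 // mul0rn addr0.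
case/combs_consP=> z [q [_ qs ->]].
have [k kK ek] : congr_pair n q.
  by apply: IHs qs => r rs; apply: sn; rewrite inE rs orbT.
have [l lK el] : congr_pair n a by apply: sn; rewrite mem_head.
exists (l *~ z + k); first by rewrite rpredD // rpredMz.
have fstE : (a *~ z + q).1 = a.1 *~ z + q.1 by rewrite raddfD raddfMz.
have sndE : (a *~ z + q).2 = a.2 *~ z + q.2 by rewrite raddfD raddfMz.
rewrite fstE sndE ek el; zmod.
Qed.

Lemma congr_pair_swap n p : congr_pair n p -> congr_pair n (p.2, p.1).
Proof.
case=> k kK ek; exists (- k); first by rewrite rpredN.
rewrite /= ek; zmod.
Qed.

Definition swap_pair p : G * G := (p.2, p.1).
Fact swap_pair_zmod : zmod_morphism swap_pair.
Proof. by []. Qed.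
HB.instance Definition _ :=
  GRing.isZmodMorphism.Build (G * G)%type (G * G)%type swap_pair swap_pair_zmod.

(** Symmetry of the game: the converse implications for atoms and existential formulas follow from
    it. *)
Lemma matched_swap m s : matched m s -> matched m (map swap_pair s).
Proof.
case=> sm sside; split=> p.
  by case/mapP=> q /sm qm ->; apply: congr_pair_swap.
by case/combs_map => q /sside qside ->; apply: same_side_swap.
Qed.

Lemma matched_dvd m n s : (0 < n)%N -> (m %| n)%N -> matched n s -> matched m s.
Proof.
move=> n0 mn [sn sside]; split=> p.
  by move/sn; apply: congr_pair_dvd.
by move/(combsS (dvdn_leq n0 mn))/sside.
Qed.

(** For 0 < d <= m, the combination d x + r is multiplied by e = m! / d. It becomes m! x + e r,
    where e r has coefficients at most m m!, and e is cancelled afterwards. Negative coefficients of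
    x reduce to positive ones by negation. *)
Lemma matched_cons m n s x x' :
  (0 < m)%N -> (0 < n)%N -> (m %| n)%N -> matched n s ->
  congr_pair m (x, x') ->
  (forall q, q \in combs (m * m`!) s ->
     same_side S (x *+ m`! - q.1, x' *+ m`! - q.2)) ->
  matched m ((x, x') :: s).
Proof.
move=> m0 n0 mn sn xx' xq; have [sm sside] := matched_dvd n0 mn sn; split=> p.
  by rewrite inE => /predU1P[->//|/sm].
case/combs_consP=> z [q [zm qs ->]].
have key d r : (0 < d <= m)%N -> r \in combs m s ->
    same_side S ((x, x') *+ d + r).
  case/andP=> d0 dm rs.
  have /dvdnP[e eL] : (d %| m`!)%N by apply: dvdn_fact; rewrite d0.
  have e0 : (0 < e)%N by move: (fact_gt0 m); rewrite eL; case: (e).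
  have eleL : (e <= m`!)%N by rewrite eL leq_pmulr.
  apply: (same_side_muln_inv e0).
  have := xq (- (r *+ e)) (combsN (combsMn eleL rs)).
  suff -> : (x *+ m`! - (- (r *+ e)).1, x' *+ m`! - (- (r *+ e)).2) =
    ((x, x') *+ d + r) *+ e by [].
  rewrite eL {xq eleL eL}.
  by apply: injective_projections; rewrite !(raddfMn, raddfD, raddfN) /=; zmod.
case: (ltgtP z 0) => z0.
- have -> : (x, x') *~ z + q = - ((x, x') *+ `|z|%N + - q).
    have -> : z = - (`|z|%N)%:Z by lia.
    by rewrite abszN absz_nat; zmod.
  by apply/same_sideN/key; [lia|exact: combsN].
- have -> : z = (`|z|%N)%:Z by lia.
  by apply: key => //; lia.
- by rewrite z0 mulr0z add0r; apply: sside.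
Qed.

(** Only max A and min B matter. If a list is empty, its bound is invented at distance
    [one *+ (2 * n) + g] from the other one, or from 0 if both are empty. *)
Lemma regular_between_seq n (A B : seq G) :
  {subset S <= K} -> (exists2 g, g \in K & g \notin S) -> one \in K ->
  regular_at n -> {subset A <= K} -> {subset B <= K} ->
  (forall a b, a \in A -> b \in B -> posm S (b - a - one *+ (2 * n))) ->
  exists2 t, t \in K &
    (forall a, a \in A -> posm S (t *+ n - a)) /\
    (forall b, b \in B -> posm S (b - t *+ n)).
Proof.
move=> SK gap oK regn AK BK AB.
have [g gK gpos] := posm_gap gap.
have [p1 p1K [Ap1 p1B]] : exists2 p1, p1 \in K &
    (forall a, a \in A -> a <= p1) /\
    (forall b, b \in B -> posm S (b - p1 - one *+ (2 * n))).
  case: A AK AB => [_ _|a A AK AB].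
    have [b [bK Bb]] : exists b, b \in K /\ forall b', b' \in B -> b <= b'.
      case: B BK => [|b B] BK; first by exists 0; rewrite rpred0.
      by have [c cB cmin] := seq_min b B; exists c; split=> //; apply: BK.
    exists (b - one *+ (2 * n) - g); first by rewrite !rpredB ?rpredMn.
    split=> // b' /Bb bb'.
    have -> : b' - (b - one *+ (2 * n) - g) - one *+ (2 * n) = g + (b' - b)
      by zmod.
    by apply: posmD => //; left; rewrite oz_subr_ge0.
  have [c cA cmax] := seq_max a A.
  by exists c; [exact: AK|split=> // b; apply: AB].
have [p2 p2K [Bp2 p12]] : exists2 p2, p2 \in K &
    (forall b, b \in B -> p2 <= b) /\ posm S (p2 - p1 - one *+ (2 * n)).
  case: B BK {AB} p1B => [_ _|b B BK p1B].
    exists (p1 + one *+ (2 * n) + g); first by rewrite !rpredD ?rpredMn.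
    split=> //; have -> // : p1 + one *+ (2 * n) + g - p1 - one *+ (2 * n) = g.
    by zmod.
  have [c cB cmin] := seq_min b B.
  by exists c; [exact: BK|split=> //; apply: p1B].
have [t tK [t1 t2]] := regn p1 p2 p1K p2K p12.
exists t => //; split=> [a /Ap1|b /Bp2]; rewrite -oz_subr_ge0 => H.
  have -> : t *+ n - a = t *+ n - p1 + (p1 - a) by zmod.
  by apply: posmD t1 _; left.
have -> : b - t *+ n = p2 - t *+ n + (b - p2) by zmod.
by apply: posmD t2 _; left.
Qed.

(** Subtracting [one] from a positive coset either reaches S, which [zi] excludes, or leaves it
    positive. *)
Lemma posm_sub_muln j z :
  (forall y, posm S y -> y - one \notin S -> posm S (y - one)) ->
  (forall i, (i <= j)%N -> z - one *+ i \notin S) -> posm S z ->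
  posm S (z - one *+ j).
Proof.
move=> step zi pz; elim: j zi => [|j IHj] zi.
  by rewrite mulr0n subr0.
have -> : z - one *+ j.+1 = z - one *+ j - one by zmod.
apply: step; first by apply: IHj => i ij; apply/zi/leqW.
have -> : z - one *+ j - one = z - one *+ j.+1 by zmod.
exact: zi.
Qed.

(* Multiplying by m! brings all comparisons of multiples d x, d <= m, with
   combinations of s to the form m! x < q. *)
Definition ext_bound m := (4 * m * m`!)%N.

(** The answer has the form x' = x + m t with t in K, which secures the congruence. With n = m m!,
    m! x' = m! x + n t, so its comparison with q.2 becomes that of n t with q.2 - m! x: a question
    about multiples of n in an interval of K / S. *)
Lemma matched_extend m s x : (0 < m)%N -> regular (ext_bound m) ->
  (one, one) \in s -> matched (ext_bound m) s ->
  exists x', matched m ((x, x') :: s).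
Proof.
move=> m0 regM os sM.
have [[SK gap] oK step regn] := regM.
set n := (m * m`!)%N; set L := m`! in n *.
have L0 : (0 < L)%N by apply: fact_gt0.
have n0 : (0 < n)%N by rewrite muln_gt0 m0.
(* The factor 4 is spent below as 3n + n in the forced case and as n + n + 2n for r - q - 2n
   [one]. *)
have eM : ext_bound m = (4 * n)%N by rewrite /ext_bound /n mulnA.
have M0 : (0 < ext_bound m)%N by rewrite eM; lia.
have mM : (m %| ext_bound m)%N by rewrite eM /n mulnCA dvdn_mulr.
have nM : (n %| ext_bound m)%N by rewrite eM dvdn_mull.
have [sK sside] := sM; rewrite eM in sside.
have scongr k p : p \in combs k s -> congr_pair n p.
  by move/(congr_combs sK)/(congr_pair_dvd nM).
(* If m! x is a combination q up to S, then x' is forced; otherwise it only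
   has to lie in some interval and congruence class. *)
have [[q [qs qx]]|noq] :=
    pselect (exists q, q \in combs (3 * n) s /\ x *+ L - q.1 \in S).
  have [k kK ek] := scongr _ _ qs.
  (* Since q.2 = q.1 + k n, this choice makes m! x' - q.2 equal to m! x - q.1, an element of S. *)
  exists (x + k *+ m); apply: (matched_cons m0 M0 mM sM).
    by exists k.
  move=> r rs.
  have -> : (x *+ L - r.1, (x + k *+ m) *+ L - r.2) =
      (q - r) + (x *+ L - q.1, x *+ L - q.1).
    by apply: injective_projections => /=; rewrite ?ek /n; zmod.
  apply: same_sideD => //; apply: sside.
  have -> : (4 * n = 3 * n + n)%N by lia.
  exact: combsD qs (combsN rs).
have notS q : q \in combs (3 * n) s -> x *+ L - q.1 \notin S.
  by move=> qs; apply: contra_notN noq => qx; exists q.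
(* Combinations whose distance from m! x lies outside K impose nothing on t: adding an element of K
   does not change the side. *)
pose Q := [seq q <- combs n s | x *+ L - q.1 \in K].
pose A := [seq q.2 - x *+ L | q <- Q & posm S (x *+ L - q.1)].
pose B := [seq q.2 - x *+ L | q <- Q & posm S (q.1 - x *+ L)].
have QK q : q \in Q -> q.2 - x *+ L \in K.
  rewrite mem_filter => /andP[qK /scongr[k kK ->]].
  have -> : q.1 + k *+ n - x *+ L = - (x *+ L - q.1) + k *+ n by zmod.
  by rewrite rpredD ?rpredN ?rpredMn.
have [] := @regular_between_seq n A B SK gap oK (regn _ n0 nM).
- by move=> a /mapP[q]; rewrite mem_filter => /andP[_ /QK qK] ->.
- by move=> a /mapP[q]; rewrite mem_filter => /andP[_ /QK qK] ->.
- move=> _ _ /mapP[q qA ->] /mapP[r rB ->].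
  move: qA rB; rewrite !mem_filter.
  case/andP=> qpos /andP[_ qs] /andP[rpos /andP[_ rs]].
  have os' : (one, one) *+ (2 * n) \in combs (2 * n) s.
    by have := combsMn (leqnn (2 * n)) (mem_combs os); rewrite mul1n.
  (* The required gap is established on first components, where m! x separates q from r, and then
     transferred to second components. *)
  have := @same_side_posm _ S (r - q - (one, one) *+ (2 * n)).
  have -> : (r - q - (one, one) *+ (2 * n)).1 = r.1 - q.1 - one *+ (2 * n).
    by rewrite !raddfB raddfMn.
  have -> : (r - q - (one, one) *+ (2 * n)).2 =
     r.2 - x *+ L - (q.2 - x *+ L) - one *+ (2 * n).
    rewrite !raddfB raddfMn /=; zmod.
  apply.
    apply: sside; have -> : (4 * n = n + n + 2 * n)%N by lia.
    exact: combsD (combsD rs (combsN qs)) (combsN os').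
  have -> : r.1 - q.1 - one *+ (2 * n) =
     (x *+ L - q.1 - one *+ (2 * n)) + (r.1 - x *+ L) by zmod.
  apply: posmD; last by left; apply: posm_ge0 rpos.
  (* Each q + i [one] with i <= 2n is a combination with coefficients at most 3n, so m! x avoids its
     coset. *)
  apply: (posm_sub_muln step) qpos.
  move=> i ij.
  have -> : x *+ L - q.1 - one *+ i = x *+ L - (q + (one, one) *+ i).1.
    rewrite raddfD raddfMn /=; zmod.
  apply: notS; have -> : (3 * n = n + 2 * n)%N by lia.
  apply: combsD qs _.
  by have := combsMn ij (mem_combs os); rewrite mul1n.
move=> t tK [tA tB]; exists (x + t *+ m); apply: (matched_cons m0 M0 mM sM).
  by exists t.
move=> q qs; have qS : x *+ L - q.1 \notin S.
  by apply: notS; apply: combsS qs; lia.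
have [k kK ek] := scongr _ _ qs.
have e2 : (x + t *+ m) *+ L - q.2 = (x *+ L - q.1) + (t *+ n - k *+ n).
  by rewrite ek /n; zmod.
have tkK : t *+ n - k *+ n \in K by rewrite rpredB ?rpredMn.
have [qK|qK] := boolP (x *+ L - q.1 \in K).
  have qQ : q \in Q by rewrite mem_filter qK.
  case: (posm_trich S (x *+ L - q.1)) => [|px|px]; first by rewrite (negbTE qS).
    constructor 2; split=> //=.
    have -> : (x + t *+ m) *+ L - q.2 = t *+ n - (q.2 - x *+ L).
      by rewrite /n; zmod.
    by apply/tA/map_f; rewrite mem_filter px.
  constructor 3; split=> //=.
  have -> : - ((x + t *+ m) *+ L - q.2) = q.2 - x *+ L - t *+ n.
    by rewrite /n; zmod.
  by apply/tB/map_f; rewrite mem_filter qQ andbT; rewrite opprB in px.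
rewrite e2; case: (posm_trich K (x *+ L - q.1)) => [|px|px].
- by rewrite (negbTE qK).
- constructor 2; split; first exact: posm_sub px.
  by apply: (posm_sub SK); apply: posmD px _; right.
- constructor 3; split; first exact: posm_sub px.
  apply: (posm_sub SK); rewrite /= opprD; apply: posmD px _; right.
  by rewrite rpredN.
Qed.

Lemma regular_dvd m n : (m %| n)%N -> regular n -> regular m.
Proof.
move=> mn [SK oK step regn]; split=> // d d0 dm; apply: regn => //.
exact: dvdn_trans dm mn.
Qed.

(** * Matched tuples satisfy the same formulas *)

Fixpoint term_bound (t : og_term) : nat :=
  match t with
  | OgVar _ | OgZero => 1
  | OgOpp t1 => term_bound t1
  | OgAdd t1 t2 => term_bound t1 + term_bound t2
  end.

(** The product for [OgAnd] is a common multiple: matching and regularity both pass to divisors. *)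
Fixpoint formula_bound (phi : og_formula) : nat :=
  match phi with
  | OgEq t1 t2 | OgLt t1 t2 => term_bound t1 + term_bound t2
  | OgNot phi1 => formula_bound phi1
  | OgAnd phi1 phi2 => formula_bound phi1 * formula_bound phi2
  | OgExists phi1 => ext_bound (formula_bound phi1)
  end.

Lemma term_bound_gt0 t : (0 < term_bound t)%N.
Proof. by elim: t => //= t1 IH1 t2 IH2; rewrite addn_gt0 IH1. Qed.

Lemma ext_bound_gt0 m : (0 < m)%N -> (0 < ext_bound m)%N.
Proof. by move=> m0; rewrite /ext_bound !muln_gt0 fact_gt0 m0. Qed.

Lemma dvdn_ext_bound m : (m %| ext_bound m)%N.
Proof. by rewrite /ext_bound -mulnA mulnCA dvdn_mulr. Qed.

Lemma formula_bound_gt0 phi : (0 < formula_bound phi)%N.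
Proof.
elim: phi => //= [t1 t2|t1 t2|phi1 IH1 phi2 IH2|phi1 IH1].
- by rewrite addn_gt0 term_bound_gt0.
- by rewrite addn_gt0 term_bound_gt0.
- by rewrite muln_gt0 IH1.
- exact: ext_bound_gt0.
Qed.

Lemma eval_combs s r t : {subset s <= r} ->
  (og_eval (map fst s) t, og_eval (map snd s) t) \in combs (term_bound t) r.
Proof.
move=> sr; elim: t => [i||t IH|t1 IH1 t2 IH2] /=.
- have [si|si] := ltnP i (size s).
    rewrite !(nth_map 0) // -surjective_pairing.
    exact/mem_combs/sr/mem_nth.
  (* An index beyond the environment reads as 0, the zero combination. *)
  by rewrite !nth_default ?size_map // combs0.
- exact: combs0.
- exact: (combsN IH).
- exact: (combsD IH1 IH2).
Qed.

(** Induction on phi: an atom is decided by the combination t1 - t2 or t2 - t1, an existential by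
    [matched_extend]. The pair of [one] sits at the end of the matched tuple, outside the
    environment, so no variable index shifts. *)
Lemma og_holds_matched phi s : regular (formula_bound phi) ->
  matched (formula_bound phi) (rcons s (one, one)) ->
  og_holds (map fst s) phi <-> og_holds (map snd s) phi.
Proof.
have srcons r : {subset r <= rcons r (one, one)}.
  by move=> p pr; rewrite mem_rcons inE pr orbT.
have swapE r : map swap_pair (rcons r (one, one)) =
    rcons (map swap_pair r) (one, one) by rewrite map_rcons.
have fst_swap r : map fst (map swap_pair r) = map snd r by rewrite -map_comp.
have snd_swap r : map snd (map swap_pair r) = map fst r by rewrite -map_comp.
elim: phi s => [t1 t2|t1 t2|phi IH|phi1 IH1 phi2 IH2|phi IH] s reg gs /=.
- have sub r : matched (term_bound t1 + term_bound t2) (rcons r (one, one)) ->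
      og_eval (map fst r) t1 = og_eval (map fst r) t2 ->
      og_eval (map snd r) t1 = og_eval (map snd r) t2.
    case=> _ rside e; have := rside _ (combsD (eval_combs t1 (srcons r))
      (combsN (eval_combs t2 (srcons r)))).
    move/same_side_eq0 => /=; rewrite e subrr => /(_ erefl) /eqP.
    by rewrite subr_eq0 => /eqP.
  split; first exact: sub.
  have := sub (map swap_pair s); rewrite fst_swap snd_swap -swapE; apply.
  exact: matched_swap.
- have lt_subr x y : (x < y) = (0 < y - x).
    by rewrite !lt_neqAle oz_subr_ge0 [0 == _]eq_sym subr_eq0 [y == x]eq_sym.
  have sub r : matched (term_bound t1 + term_bound t2) (rcons r (one, one)) ->
      og_eval (map fst r) t1 < og_eval (map fst r) t2 ->
      og_eval (map snd r) t1 < og_eval (map snd r) t2.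
    rewrite addnC; case=> _ rside; have := rside _ (combsD
      (eval_combs t2 (srcons r)) (combsN (eval_combs t1 (srcons r)))).
    by move/same_side_gt0 => /=; rewrite -!lt_subr.
  split; first exact: sub.
  have := sub (map swap_pair s); rewrite fst_swap snd_swap -swapE; apply.
  exact: matched_swap.
- by have := IH s reg gs; tauto.
- have n0 : (0 < formula_bound phi1 * formula_bound phi2)%N.
    exact: (formula_bound_gt0 (OgAnd phi1 phi2)).
  have d1 := dvdn_mulr (formula_bound phi2) (dvdnn (formula_bound phi1)).
  have d2 := dvdn_mull (formula_bound phi1) (dvdnn (formula_bound phi2)).
  have := IH1 s (regular_dvd d1 reg) (matched_dvd n0 d1 gs).
  have := IH2 s (regular_dvd d2 reg) (matched_dvd n0 d2 gs).
  tauto.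
- have sub r : matched (ext_bound (formula_bound phi)) (rcons r (one, one)) ->
      (exists x, og_holds (x :: map fst r) phi) ->
      exists x, og_holds (x :: map snd r) phi.
    move=> gr [x xphi].
    have oor : (one, one) \in rcons r (one, one) by rewrite mem_rcons mem_head.
    have [x' gx] := matched_extend x (formula_bound_gt0 phi) reg oor gr.
    exists x'; have := IH ((x, x') :: r).
    by case/(_ (regular_dvd (dvdn_ext_bound _) reg) gx) => + _; apply.
  split; first exact: sub.
  have := sub (map swap_pair s); rewrite fst_swap snd_swap -swapE; apply.
  exact: matched_swap.
Qed.

(** * Matched elements on both sides of H *)

(** x is chosen in H so that m! x lies above all relevant combinations of b in H, even modulo S. y =
    x + m t is chosen so that m! y lies, modulo H, halfway between H and the least relevant
    combination u of b in K above H. No combination then separates the two. *)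
Lemma matched_across (H : convexSubgroup G) m (b : seq G) : (0 < m)%N ->
  {subset S <= H} -> {subset H <= K} ->
  (exists2 a, a \in H & a \notin S) -> (exists2 g, g \in K & g \notin H) ->
  (forall k, k \in K ->
     exists2 t, t \in K & k - t *+ (2 * (m * m`!)) \in H) ->
  exists x y,
    [/\ x \in H, y \notin H & matched m ((x, y) :: [seq (g, g) | g <- b])].
Proof.
move=> m0 SH HK /posm_gap[a aH apos] /posm_gap[g gK gpos] Kdiv.
move: Kdiv; set n := (m * m`!)%N; set L := m`! in n * => Kdiv.
have L0 : (0 < L)%N by apply: fact_gt0.
pose Q := combs n b.
have [c /[1!inE] cA cmax] := seq_max 0 [seq q <- Q | q \in H].
have cH : c \in H.
  by case/predU1P: cA => [->|]; rewrite ?rpred0 // mem_filter => /andP[].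
have c0 : 0 <= c by apply: cmax; rewrite mem_head.
pose x := c + a.
have xH : x \in H by rewrite rpredD.
have x0 : 0 <= x by rewrite oz_addr_ge0 ?(posm_ge0 apos).
have xpos (q : G) : q \in Q -> q \in H -> posm S (x *+ L - q).
  move=> qQ qH; have -> : x *+ L - q = a *+ L + (c *+ L - q).
    by rewrite /x; zmod.
  apply: posmD; first exact: posm_muln.
  left; rewrite oz_subr_ge0; apply: le_trans (oz_ler_mulrn c0 L0).
  by apply: cmax; rewrite inE mem_filter qH qQ orbT.
(* The element g stands in when no combination lies in K above H. *)
have [u /[1!inE] uB umin] := seq_min g [seq q <- Q | (q \in K) && posm H q].
have [uK upos] : u \in K /\ posm H u.
  by case/predU1P: uB => [->|] //; rewrite mem_filter => /andP[/andP[]].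
have xLH : - (x *+ L) \in H by rewrite rpredN rpredMn.
have ppos : posm H (u - x *+ L) by apply: posmD => //; right.
(* Modulo H, u is 2n t, so n t is half of u; this is the origin of the factor 2 in [Kdiv]. *)
have [t tK tH] : exists2 t, t \in K & u - x *+ L - t *+ (2 * n) \in H.
  by apply: Kdiv; rewrite rpredD // (HK _ xLH).
have tpos : posm H t.
  apply: (@posm_muln_inv _ _ _ (2 * n)); first by rewrite !muln_gt0 m0.
  have -> : t *+ (2 * n) = u - x *+ L + - (u - x *+ L - t *+ (2 * n)) by zmod.
  by apply: posmD => //; right; rewrite rpredN.
have tnpos : posm H (t *+ n) by apply: posm_muln; rewrite ?muln_gt0 ?m0.
have eyL (q : G) : (x + t *+ m) *+ L - q = t *+ n + (x *+ L - q).
  by rewrite /n; zmod.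
exists x, (x + t *+ m); split=> //.
  apply: posm_notin; rewrite addrC; apply: posmD; last by left.
  exact: posm_muln.
pose dup (z : G) : G * G := (z, z).
have dup_zmod : zmod_morphism dup by [].
pose dupA : {additive G -> G * G} := HB.pack dup
  (GRing.isZmodMorphism.Build G (G * G)%type dup dup_zmod).
apply: (@matched_cons m m) => //.
- split=> p.
    by case/mapP=> z _ ->; exists 0; rewrite ?rpred0 // mul0rn addr0.
  by case/(@combs_map _ _ dupA) => z _ ->; constructor 1.
- by exists t.
move=> p; case/(@combs_map _ _ dupA) => q qQ -> /=; rewrite -/L.
have [qH|qH] := boolP (q \in H).
  constructor 2; split=> /=; first exact: xpos.
  rewrite eyL; apply: (posm_sub SH); apply: posmD => //; right.
  by rewrite rpredB ?rpredMn.
case: (posm_trich H q) => [|qpos|qpos]; first by rewrite (negbTE qH).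
  have qx : posm H (- (x *+ L - q)).
    have -> : - (x *+ L - q) = q + - (x *+ L) by zmod.
    by apply: posmD => //; right.
  constructor 3; split=> /=; first exact: posm_sub qx.
  apply: (posm_sub SH); rewrite eyL.
  have [qK|qK] := boolP (q \in K).
    have uq : u <= q.
      by apply: umin; rewrite inE mem_filter qK qpos qQ orbT.
    have -> : - (t *+ n + (x *+ L - q)) =
      (t *+ n + (u - x *+ L - t *+ (2 * n))) + (q - u) by zmod.
    apply: posmD; last by left; rewrite oz_subr_ge0.
    by apply: posmD => //; right.
  apply: (posm_sub HK).
  have -> : - (t *+ n + (x *+ L - q)) = q + - (t *+ n + x *+ L) by zmod.
  apply: posmD; first by rewrite /posm (posm_ge0 qpos).
  by right; rewrite rpredN rpredD ?rpredMn ?(HK _ xH).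
have qx : posm H (x *+ L - q).
  by rewrite addrC; apply: posmD => //; right; rewrite -rpredN.
constructor 2; split=> /=; first exact: posm_sub qx.
apply: (posm_sub SH); rewrite eyL addrC; apply: posmD => //; left.
exact: posm_ge0 tnpos.
Qed.

End Game.

(** S, K and [one] may depend on the defining formula through N. The value N = 4 m m! is a multiple
    of m, for regularity, and of 2 m m!, for the divisibility of K / H in [matched_across]. *)
Lemma regular_not_definable (G : orderedZmodType) (H : convexSubgroup G) :
  (forall N, (0 < N)%N -> exists (S K : convexSubgroup G) (one : G),
     [/\ regular S K one N,
         {subset S <= H} /\ (exists2 a, a \in H & a \notin S),
         {subset H <= K} /\ (exists2 g, g \in K & g \notin H)
       & forall k, k \in K -> exists2 t, t \in K & k - t *+ N \in H]) ->
  ~ og_definable H.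
Proof.
move=> Hreg [phi [b bphi]].
pose m := formula_bound phi; have m0 : (0 < m)%N := formula_bound_gt0 phi.
have N0 := ext_bound_gt0 m0.
have [S [K [one [reg [SH Sgap] [HK Kgap] Kdiv]]]] := Hreg _ N0.
have eN : ext_bound m = (2 * (2 * (m * m`!)))%N.
  by rewrite /ext_bound -mulnA (mulnA 2 2).
have Kdiv' k : k \in K -> exists2 t, t \in K & k - t *+ (2 * (m * m`!)) \in H.
  case/Kdiv => t tK tH; exists (t *+ 2); first by rewrite rpredMn.
  by rewrite -mulrnA -eN.
have [x [y [xH yH gxy]]] :=
  matched_across (rcons b one) m0 SH HK Sgap Kgap Kdiv'.
rewrite map_rcons in gxy.
have := @og_holds_matched _ _ _ _ phi ((x, y) :: [seq (g, g) | g <- b])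
  (regular_dvd (dvdn_ext_bound m) reg) gxy.
have fst_dup : [seq p.1 | p <- [seq (g, g) | g <- b]] = b.
  by rewrite -map_comp map_id.
have snd_dup : [seq p.2 | p <- [seq (g, g) | g <- b]] = b.
  by rewrite -map_comp map_id.
rewrite /= fst_dup snd_dup -!bphi => -[/(_ xH) yH' _].
by rewrite yH' in yH.
Qed.

(** * Absolute values and the convex subgroups obtained from the hypotheses *)

Section OrderMore.
Variable G : orderedZmodType.
Implicit Types x y z : G.

Lemma oz_lerD x y z w : x <= y -> z <= w -> x + z <= y + w.
Proof.
move=> xy zw; apply: (@le_trans _ _ (x + w)); first by rewrite oz_lerD2l.
by rewrite ![_ + w]addrC oz_lerD2l.
Qed.

Lemma oz_lerN x y : x <= y -> - y <= - x.
Proof. by rewrite -oz_subr_ge0 -(oz_subr_ge0 (- y)) opprK addrC. Qed.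

Lemma oz_ler_muln2r n x y : x <= y -> x *+ n <= y *+ n.
Proof.
rewrite -[x <= y]oz_subr_ge0 -[_ <= y *+ n]oz_subr_ge0 -mulrnBl.
exact: oz_mulrn_ge0. Qed.

Lemma oz_ler_muln2r_cancel n x y : (0 < n)%N -> x *+ n <= y *+ n -> x <= y.
Proof.
move=> n0; rewrite -[x <= y]oz_subr_ge0 -[_ <= y *+ n]oz_subr_ge0 -mulrnBl.
move=> yx.
case: (oz_ge0_or_le0 (y - x)) => // xy.
suff -> : y - x = 0 by [].
apply: (oz_mulrn_eq0 n0); apply/le_anti; rewrite yx andbT.
by rewrite -oz_oppr_ge0 -mulNrn oz_mulrn_ge0.
Qed.

Lemma oz_abs_ge0 x : 0 <= oz_abs x.
Proof.
rewrite /oz_abs; case: ifPn => // x0; case: (oz_ge0_or_le0 x) => //.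
by rewrite (negbTE x0).
Qed.

Lemma oz_ler_abs x : x <= oz_abs x.
Proof.
rewrite /oz_abs; case: ifPn => // x0; case: (oz_ge0_or_le0 x) => [|nx].
  by rewrite (negbTE x0).
by apply: (le_trans _ nx); rewrite -oz_oppr_ge0.
Qed.

Lemma oz_abs_eq0 x : oz_abs x = 0 -> x = 0.
Proof.
by rewrite /oz_abs; case: ifP => // _ /eqP; rewrite oppr_eq0 => /eqP.
Qed.

Lemma oz_ler_mulz x (z : int) : 0 <= x -> x *~ z <= x *+ `|z|%N.
Proof.
case: z => n x0 //; apply: (@le_trans _ _ 0); last exact: oz_mulrn_ge0.
by rewrite -oz_oppr_ge0 NegzE mulrNz opprK oz_mulrn_ge0.
Qed.

End OrderMore.

(* The largest convex subgroup not containing a, when a is nonzero. *)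
Definition infinitesimal (G : orderedZmodType) (a : G) : {pred G} :=
  fun g => `[< forall z : int, g *~ z <= oz_abs a >].

Section Infinitesimal.
Variables (G : orderedZmodType) (a : G).

Lemma infinitesimalP g :
  reflect (forall z : int, g *~ z <= oz_abs a) (g \in infinitesimal a).
Proof. exact: asboolP. Qed.

Fact infinitesimal_zmod_closed : zmod_closed (infinitesimal a).
Proof.
split=> [|x y /infinitesimalP xa /infinitesimalP ya]; apply/infinitesimalP => z.
  by rewrite mul0rz oz_abs_ge0.
(* After doubling, each of the two summands is bounded by |a| separately. *)
apply: (@oz_ler_muln2r_cancel _ 2) => //.
have -> : (x - y) *~ z *+ 2 = x *~ (z *+ 2) + y *~ - (z *+ 2) by zmod.
by rewrite [X in _ <= X]mulr2n; apply: oz_lerD.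
Qed.

Fact infinitesimal_convex (x y w : G) : x \in infinitesimal a ->
  w \in infinitesimal a -> x <= y -> y <= w -> y \in infinitesimal a.
Proof.
move=> /infinitesimalP xa /infinitesimalP wa xy yw; apply/infinitesimalP.
case=> n; first exact: le_trans (oz_ler_muln2r n yw) (wa n%:Z).
apply: le_trans (xa (Negz n)); rewrite !NegzE !mulrNz.
exact/oz_lerN/oz_ler_muln2r.
Qed.

HB.instance Definition _ :=
  GRing.isZmodClosed.Build G (infinitesimal a) infinitesimal_zmod_closed.
HB.instance Definition _ :=
  isConvex.Build G (infinitesimal a) infinitesimal_convex.

End Infinitesimal.

Section Preimage.
Variables (G : orderedZmodType) (H : convexSubgroup G).
Variable C : convexSubgroup (oquot H).

Definition quot_preim : {pred G} := fun g => \pi_(oquot H)%qT g \in C.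

Fact quot_preim_zmod_closed : zmod_closed quot_preim.
Proof.
split=> [|x y xC yC]; rewrite unfold_in.
  by rewrite raddf0 rpred0.
by rewrite raddfB rpredB.
Qed.

Fact quot_preim_convex (x y z : G) : x \in quot_preim -> z \in quot_preim ->
  x <= y -> y <= z -> y \in quot_preim.
Proof.
move=> xC zC xy yz; apply: (convex_subproof _ _ _ xC zC).
  by change (oquot_le (\pi_(oquot H)%qT x) (\pi_(oquot H)%qT y));
    rewrite pi_oquot_le xy.
by change (oquot_le (\pi_(oquot H)%qT y) (\pi_(oquot H)%qT z));
  rewrite pi_oquot_le yz.
Qed.

HB.instance Definition _ :=
  GRing.isZmodClosed.Build G quot_preim quot_preim_zmod_closed.
HB.instance Definition _ :=
  isConvex.Build G quot_preim quot_preim_convex.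

End Preimage.

Lemma divisible_quot_preim (G : orderedZmodType) (H : convexSubgroup G) n :
  (exists C : convexSubgroup (oquot H), nontrivial C /\ n_divisible n C) ->
  exists K : convexSubgroup G,
    [/\ {subset H <= K}, exists2 g, g \in K & g \notin H
      & forall k, k \in K -> exists2 t, t \in K & k - t *+ n \in H].
Proof.
case=> C [[q qC q0] Cdiv].
pose K : convexSubgroup G := ConvexSubgroup.clone G (quot_preim C) _.
have inK (g : G) : (g \in K) = (\pi_(oquot H)%qT g \in C) by [].
have piH (g : G) : (\pi_(oquot H)%qT g == 0) = (g \in H).
  by rewrite -(raddf0 \pi_(oquot H)%qT) pi_oquot_eq subr0.
exists K; split.
- by move=> h; rewrite -piH inK => /eqP ->; rewrite rpred0.
- by exists (repr q); rewrite ?inK -?piH reprK.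
- move=> k; rewrite inK => /Cdiv[y yC ey]; exists (repr y).
    by rewrite inK reprK.
  by rewrite -pi_oquot_eq raddfMn /= reprK ey.
Qed.

Lemma divisible_sub_quot (G : orderedZmodType) (H S : convexSubgroup G) n :
  n_divisible n (sub_quot H S) ->
  forall h, h \in H -> exists2 t, t \in H & h - t *+ n \in S.
Proof.
move=> Hdiv h hH; have [|y /asboolP[t tH ->] ey] := Hdiv (\pi_(oquot S)%qT h).
  by apply/asboolP; exists h.
by exists t => //; rewrite -pi_oquot_eq raddfMn /= ey.
Qed.

(** The least value belongs to the largest archimedean class, so a multiple of |a| bounds any given
    element of H. S consists of the elements infinitesimal to a; a positive e outside S has a
    multiple above |a|, hence multiples above every element of H. *)
Lemma archimedean_quot (G : orderedZmodType) (H : convexSubgroup G) :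
  has_arch_min (@natval G @` [set x | x \in H /\ x != 0])%classic ->
  exists S : convexSubgroup G,
    [/\ {subset S <= H}, exists2 a, a \in H & a \notin S
      & forall e, posm S e -> forall h, h \in H -> exists j, h <= e *+ j].
Proof.
case=> A [a [aH a0] <-] amin.
have top b : b \in H -> exists n, oz_abs b <= oz_abs a *+ n.
  move=> bH; have [->|b0] := eqVneq b 0.
    by exists 0%N; rewrite /oz_abs lexx.
  have refl (c : G) : arch_equiv c c by exists 1%N; rewrite mulr1n lexx.
  case: (amin (natval b)); first by exists b.
    move=> eab; have : natval b b by exact: refl.
    by rewrite -eab => -[n [_ _ bn]]; exists n.
  (* With the representatives a', b' supplied by [arch_lt]: |b| <= k|b'| <= k|a'| <= kn|a|. *)
  case=> a' [b' [ea eb b'a' _]].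
  have : natval a' a by rewrite -ea; exact: refl.
  case=> n [_ a'n _].
  have : natval b' b by rewrite -eb; exact: refl.
  case=> k [_ _ bk]; exists (n * k)%N; rewrite mulrnA.
  apply: le_trans bk _; apply: oz_ler_muln2r.
  exact: le_trans (ltW b'a') a'n.
exists (ConvexSubgroup.clone G (infinitesimal a) _); split.
- move=> g /infinitesimalP ga.
  have absH : oz_abs a \in H.
    by rewrite /oz_abs; case: ifP => _; rewrite ?rpredN.
  apply: (convex_subproof (- oz_abs a) _ (oz_abs a)) => //.
  + by rewrite rpredN.
  + by have /oz_lerN := ga (-1); rewrite mulrN1z opprK.
  + exact: (ga 1).
- exists a => //; apply/infinitesimalP => aa; case/eqP: a0; apply: oz_abs_eq0.
  apply/le_anti; rewrite oz_abs_ge0 andbT.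
  (* Were a infinitesimal to itself, its multiple by 2 or -2 would give 2|a| <= |a|. *)
  have : oz_abs a + oz_abs a <= oz_abs a + 0.
    rewrite addr0 {1 2}/oz_abs; case: ifP => _; first exact: (aa 2).
    by have := aa (-2); rewrite mulrNz -mulNrz.
  by rewrite oz_lerD2l.
- move=> e epos h hH; have [n hn] := top h hH.
  have /asboolPn/existsNP[z ze] := posm_notin epos.
  have {}ze : oz_abs a <= e *~ z by case/orP: (oz_le_total (oz_abs a) (e *~ z)).
  exists (`|z| * n)%N; rewrite mulrnA.
  apply: le_trans (oz_ler_abs h) (le_trans hn _); apply: oz_ler_muln2r.
  exact: le_trans ze (oz_ler_mulz _ (posm_ge0 epos)).
Qed.

(** * Regularity of K / S in the two cases *)

(** Dividing p1 + p2 by 2N modulo S makes the midpoint of the interval a multiple of N, hence of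
    n. *)
Lemma regular_divisible (G : orderedZmodType) (S K : convexSubgroup G) N :
  {subset S <= K} -> (exists2 g, g \in K & g \notin S) ->
  (forall k, k \in K -> exists2 t, t \in K & k - t *+ (2 * N) \in S) ->
  regular S K 0 N.
Proof.
move=> SK gap Kdiv; split=> //; rewrite ?rpred0 //.
  by move=> z; rewrite subr0.
move=> n n0 /dvdnP[d eN] p1 p2 p1K p2K; rewrite mul0rn subr0 => p12.
have [|t tK] := Kdiv (p1 + p2); first by rewrite rpredD.
set h := _ - _ => hS; exists (t *+ d); first by rewrite rpredMn.
split; apply: (@posm_muln_inv _ _ _ 2) => //.
  have -> : (t *+ d *+ n - p1) *+ 2 = p2 - p1 + - h.
    by rewrite /h eN; zmod.
  by apply: posmD => //; right; rewrite rpredN.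
have -> : (p2 - t *+ d *+ n) *+ 2 = p2 - p1 + h.
  by rewrite /h eN; zmod.
by apply: posmD => //; right.
Qed.

(** z is a ceiling of h / e, found as a least natural number after shifting h by i e to make it
    nonnegative. *)
Lemma arch_floor (G : orderedZmodType) (e h : G) : 0 <= e ->
  (exists j, h <= e *+ j) -> (exists j, - h <= e *+ j) ->
  exists z : int, h <= e *~ z /\ e *~ (z - 1) <= h.
Proof.
move=> e0 [j hj] [i hi].
have exP : exists k, h + e *+ i <= e *+ k.
  by exists (i + j)%N; rewrite mulrnDr addrC; apply: oz_lerD.
have hi0 : 0 <= h + e *+ i by rewrite addrC -oz_subr_ge0 opprK in hi *.
case: (ex_minnP exP) => k hk kmin; exists (k%:Z - i%:Z); split.
  rewrite -(oz_lerD2l (e *+ i)) addrC; apply: le_trans hk _.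
  by have -> : e *+ i + e *~ (k%:Z - i%:Z) = e *+ k by zmod.
rewrite -(oz_lerD2l (e *+ i)) [X in _ <= X]addrC.
case: k hk kmin => [|k] hk kmin.
  (* For k = 0 minimality says nothing; the claim is then -e <= h + i e. *)
  apply: le_trans hi0; rewrite -oz_oppr_ge0.
  by have -> : - (e *+ i + e *~ (0%:Z - i%:Z - 1)) = e by zmod.
have -> : e *+ i + e *~ (k.+1%:Z - i%:Z - 1) = e *+ k.
  have -> : k.+1%:Z = k%:Z + 1 by lia.
  zmod.
case/orP: (oz_le_total (h + e *+ i) (e *+ k)) => // /kmin; by rewrite ltnn.
Qed.

(** Modulo H, p1 is divisible by N; the remainder in H is approximated by multiples of n e for a
    positive e in H. If H / S has a least positive element, e = [one] is that element. Otherwise H /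
    S is dense, and e is taken so small that 2n e fits into the given interval, with [one] = 0. *)
Lemma regular_archimedean (G : orderedZmodType) (S H K : convexSubgroup G) N :
  {subset S <= H} -> (exists2 a, a \in H & a \notin S) ->
  {subset H <= K} -> (exists2 g, g \in K & g \notin H) ->
  (forall e, posm S e -> forall h, h \in H -> exists j, h <= e *+ j) ->
  (forall k, k \in K -> exists2 t, t \in K & k - t *+ N \in H) ->
  exists one, regular S K one N.
Proof.
move=> SH Sgap HK [g gK gH] arch Kdiv.
have SK : {subset S <= K} by move=> x /SH/HK.
have gap : exists2 g, g \in K & g \notin S.
  by exists g => //; apply: contra gH; apply: SH.
have fine e n p1 p2 : (0 < n)%N -> (n %| N)%N -> e \in H -> posm S e ->
    p1 \in K -> posm S (p2 - p1 - e *+ (2 * n)) ->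
    exists2 t, t \in K & posm S (t *+ n - p1) /\ posm S (p2 - t *+ n).
  move=> n0 /dvdnP[d eN] eH epos p1K p12.
  have [t tK hH] := Kdiv _ p1K; set h := p1 - _ in hH.
  have enpos : posm S (e *+ n) by apply: posm_muln.
  have [z [hz zh]] : exists z : int, h <= e *+ n *~ z /\ e *+ n *~ (z - 1) <= h.
    by apply: arch_floor (posm_ge0 enpos) _ _; apply: arch; rewrite ?rpredN.
  (* Using z + 1 instead of z puts the multiple of n between p1 + n e and p1 + 2n e, so it exceeds
     p1 strictly modulo S; hence the length 2n. *)
  exists (t *+ d + e *~ (z + 1)).
    by rewrite rpredD ?rpredMn ?rpredMz // (HK _ eH).
  split.
    have -> : (t *+ d + e *~ (z + 1)) *+ n - p1 = e *+ n + (e *+ n *~ z - h).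
      by rewrite /h eN; zmod.
    by apply: posmD => //; left; rewrite oz_subr_ge0.
  have -> : p2 - (t *+ d + e *~ (z + 1)) *+ n =
      p2 - p1 - e *+ (2 * n) + (h - e *+ n *~ (z - 1)).
    by rewrite /h eN; zmod.
  by apply: posmD => //; left; rewrite oz_subr_ge0.
have [[one [oH opos omin]]|dense] := pselect (exists u, [/\ u \in H, posm S u
    & forall z, posm S z -> z - u \notin S -> posm S (z - u)]).
  exists one; split=> //; first exact: HK.
  by move=> n n0 nN p1 p2 p1K _; apply: fine.
have half u : u \in H -> posm S u ->
    exists2 v, v \in H /\ posm S v & posm S (u - v).
  move=> uH upos; apply: contrapT => nov; apply: dense.
  exists u; split=> // z zpos zuS.
  case: (posm_trich S (z - u)) => // [zu|]; first by rewrite zu in zuS.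
  rewrite opprB => uz; case: nov; exists z => //; split=> //.
  apply: (convex_subproof (0 : G) z u (rpred0 H) uH (posm_ge0 zpos)).
  by rewrite -oz_subr_ge0 (posm_ge0 uz).
(* Induction splits u into v and u - v; the smaller of u - v and the element found for v fits once
   more. *)
have small n u : u \in H -> posm S u ->
    exists2 e, e \in H /\ posm S e & posm S (u - e *+ n).
  elim: n u => [|n IHn] u uH upos.
    by exists u => //; rewrite mulr0n subr0.
  have [v [vH vpos] uv] := half u uH upos.
  have [e [eH epos] ve] := IHn v vH vpos.
  case/orP: (oz_le_total e (u - v)) => euv.
    exists e => //; have -> : u - e *+ n.+1 = v - e *+ n + (u - v - e) by zmod.
    by apply: posmD => //; left; rewrite oz_subr_ge0.
  exists (u - v); first by rewrite rpredB.
  have -> : u - (u - v) *+ n.+1 = v - e *+ n + (e - (u - v)) *+ n by zmod.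
  by apply: posmD => //; left; rewrite oz_mulrn_ge0 // oz_subr_ge0.
have [b bH bpos] := posm_gap Sgap.
exists 0; split=> //; first exact: rpred0.
  by move=> z; rewrite subr0.
move=> n n0 nN p1 p2 p1K _; rewrite mul0rn subr0 => p12.
(* The interval length may lie outside H, so it is cut down to b in H when it exceeds b. *)
have [u [uH upos] up] : exists2 u, u \in H /\ posm S u & u <= p2 - p1.
  case/orP: (oz_le_total b (p2 - p1)) => bp; first by exists b.
  exists (p2 - p1) => //; split=> //.
  exact: (convex_subproof (0 : G) _ b (rpred0 H) bH (posm_ge0 p12) bp).
have [e [eH epos] ue] := small (2 * n)%N u uH upos.
apply: (fine e) => //.
have -> : p2 - p1 - e *+ (2 * n) = u - e *+ (2 * n) + (p2 - p1 - u) by zmod.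
by apply: posmD => //; left; rewrite oz_subr_ge0.
Qed.

Local Open Scope classical_set_scope.

Theorem corollary4p9 (G : orderedZmodType) (H : convexSubgroup G)
  (H_proper : exists g : G, g \notin H)
  (H_div : forall n : nat, (2 <= n)%N ->
     (exists C : convexSubgroup (oquot H), nontrivial C /\ n_divisible n C) /\
     (has_arch_min (@natval G @` [set x | x \in H /\ x != 0]) \/
      exists H' : convexSubgroup G,
        strict_sub H' H /\ n_divisible n (sub_quot H H'))) :
  ~ og_definable H.
Proof.
apply: regular_not_definable => N N0.
(* 2N is at least 2 even for N = 1, and the extra factor 2 pays for the midpoint in
   [regular_divisible]. *)
have [/divisible_quot_preim[K [HK Kgap Kdiv2]] Hcase] :=
  H_div (2 * N)%N ltac:(lia).
have Kdiv k : k \in K -> exists2 t, t \in K & k - t *+ N \in H.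
  case/Kdiv2 => t tK tH; exists (t *+ 2); first by rewrite rpredMn.
  by rewrite -mulrnA.
case: Hcase => [/archimedean_quot[S [SH Sgap arch]]|
  [S [[SH Sgap] /divisible_sub_quot Hdiv]]].
  have [one reg] := regular_archimedean SH Sgap HK Kgap arch Kdiv.
  by exists S, K, one.
exists S, K, 0; split=> //; apply: regular_divisible.
- by move=> x /SH/HK.
- by case: Kgap => g gK gH; exists g => //; apply: contra gH; apply: SH.
(* K / S is an extension of K / H by H / S: the remainder in H is divided by 2N again, modulo S. *)
- move=> k /Kdiv2[t tK /Hdiv[t' t'H t'S]]; exists (t + t').
    by rewrite rpredD // (HK _ t'H).
  have -> // : k - (t + t') *+ (2 * N) = k - t *+ (2 * N) - t' *+ (2 * N).
  zmod.
Qed.
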